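(* Let $f_0:[-1,1]\to\mathbb{R}$ be nondecreasing, square-integrable, continuous at $0$, with $f_0(0)=0$, and suppose $F_0(1)>0$, where $F_0(t)=\int_0^t f_0(s)\,ds$. Let $a_\delta>0$ be chosen small enough (depending on $f_0$), and let $H_0:[0,\infty)\to[0,\infty)$ be the associated function defined in the context. Suppose $\psi_r(s)<s$ for some $s\in(0,1)$. Let $\chi:[0,\infty)\to[0,\infty)$ be such that for some constants $K>0$ and $m\ge1$ $$\chi(a)\le H_0(a)\ \text{ for } a\le a_\delta,\qquad \chi(a)\le K H_0(a)^m\ \text{ for } a>a_\delta .$$ Let $\hat f(0)$ be the monotone least squares estimator at $0$ in the white noise model with noise level $n^{-1/2}$. Then there exist constants $L_1,L_2,\gamma,n_0>0$ such that for all $n\ge n_0$ and all $C>0$ $$\mathbb{P}\big(n^{1/2}\chi(\hat f(0)_+)\ge C\big)\le L_1e^{-L_2C^\gamma}.$$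
   Context: White noise model: one observes $Y(t)=\int_0^t f_0(s)\,ds+n^{-1/2}W(t)$, $t\in[-1,1]$, where $W$ is standard two-sided Brownian motion. Estimator: $\hat F(t)=\sup\{\phi(t):\phi\text{ affine and }\phi(s)\le Y(s)\ \forall s\in[-1,1]\}$ and $\hat f(t)=\lim_{h\downarrow0}(\hat F(t)-\hat F(t-h))/h$ for $t\in(-1,1)$. Notation: $x_+=\max(0,x)$. The function $\psi_r$ on $[0,1]$ is $\psi_r(s)=\limsup_{t\downarrow0}F_0(st)/F_0(t)$, with the convention that if $F_0(t)=0$ for some $t>0$ then $\psi_r(s)=0$ for $s\in[0,1)$ and $\psi_r(1)=1$. Let $G_0(t)=F_0(t)/t$ for $t\in(0,1]$; it is continuous and strictly increasing on $\{t\in(0,1]:F_0(t)>0\}$, so $G_0^{-1}$ is defined as a strictly increasing continuous function on $[0,F_0(1)]$ (with $G_0^{-1}(0)=\sup\{t\in[0,1]:F_0(t)=0\}$). For $0<a_\delta\le F_0(1)$ define $$H_0(a)=a\sqrt{G_0^{-1}(a)}\ \text{ for }0\le a\le a_\delta,\qquad H_0(a)=a-a_\delta+H_0(a_\delta)\ \text{ for }a>a_\delta.$$ ''$a_\delta$ small enough'' means: there is $a_*>0$ depending on $f_0$ such that the statement holds for every choice $0<a_\delta\le a_*$. *)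

(* Defs.v *)
From HB Require Import structures.
From mathcomp Require Import all_boot all_order all_algebra.
From mathcomp Require Import all_classical all_reals all_analysis.

Set Implicit Arguments.
Unset Strict Implicit.
Unset Printing Implicit Defensive.

Import Order.TTheory GRing.Theory Num.Theory.
Import numFieldNormedType.Exports.

Local Open Scope classical_set_scope.
Local Open Scope ring_scope.

Section Drift.
Context {R : realType}.
Implicit Types (f : R -> R) (t s a ad : R).

(* Oriented integral of f from 0 to t; both signs of t are needed. *)
Definition F0 f t : R :=
  if 0 <= t then \int[lebesgue_measure]_(x in `[0, t]) f x
  else - \int[lebesgue_measure]_(x in `[t, 0]) f x.

(* The limsup is taken in \bar R, along t -> 0 with t > 0. *)
Definition psi_r f s : \bar R :=
  if `[< exists2 t, 0 < t <= 1 & F0 f t = 0 >] then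
    (if s < 1 then 0%E else 1%E)
  else limf_esup (fun t => (F0 f (s * t) / F0 f t)%:E) (0 : R)^'+.

Definition G0 f t : R := F0 f t / t.

(* For 0 < a <= F0 f 1 this is the inverse of G0 on the set where F0 > 0; the
   value at 0 is fixed separately, and values outside [0, F0 f 1] are
   irrelevant. *)
Definition G0inv f a : R :=
  if a == 0 then sup [set t | 0 <= t <= 1 /\ F0 f t = 0]
  else 'pinv_(fun=> 0) [set t | 0 < t <= 1 /\ 0 < F0 f t] (G0 f) a.

Definition H0 f ad a : R :=
  if a <= ad then a * Num.sqrt (G0inv f a)
  else a - ad + ad * Num.sqrt (G0inv f ad).

End Drift.

Section Estimator.
Context {R : realType}.
Implicit Types (y : R -> R) (t : R).

(* Greatest convex minorant on [-1, 1] of the path y. *)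
Definition Fhat y t : R :=
  sup [set phi t | phi in
    [set phi : R -> R | (exists a b, forall s, phi s = a * s + b) /\
                        (forall s, -1 <= s <= 1 -> phi s <= y s)]].

Definition fhat y t : R :=
  lim ((Fhat y t - Fhat y (t - h)) / h @[h --> 0^'+]).

End Estimator.

Section WhiteNoise.
Context {R : realType} {d : measure_display} {T : measurableType d}
  (P : probability T R).

(* Two-sided Brownian motion, restricted to the time interval [-1, 1]: started
   at 0 at time 0, with continuous paths and independent increments over
   [-1, 1], where W t - W s has law N(0, t - s) for s < t.  The second argument
   of normal_prob is the standard deviation.  Since the B i may be the whole
   line, the product rule over all k increments is mutual independence. *)
Definition two_sided_brownian (W : R -> {RV P >-> R}) : Prop :=
  [/\ {ae P, forall w, W 0 w = 0},
      {ae P, forall w, {within `[-1, 1], continuous (fun t => W t w)}},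
      (forall s t : R, -1 <= s -> s < t -> t <= 1 ->
        forall B : set R, measurable B ->
          P [set w | B (W t w - W s w)] = normal_prob 0 (Num.sqrt (t - s)) B) &
      (forall (k : nat) (t : nat -> R),
        -1 <= t 0%N -> (forall i, (i < k)%N -> t i <= t i.+1) -> t k <= 1 ->
        forall B : nat -> set R, (forall i, measurable (B i)) ->
          P [set w | forall i, (i < k)%N -> B i (W (t i.+1) w - W (t i) w)] =
          (\prod_(i < k) P [set w | B i (W (t i.+1) w - W (t i) w)%R])%E)].

Definition Yobs (f : R -> R) (n : nat) (W : R -> {RV P >-> R}) (w : T) (t : R)
    : R :=
  F0 f t + (Num.sqrt n%:R)^-1 * W t w.

End WhiteNoise.

(* Main.v *)
Require Import Defs.
From HB Require Import structures.
From mathcomp Require Import all_boot all_order all_algebra.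
From mathcomp Require Import all_classical all_reals all_analysis.
From mathcomp Require Import measurable_realfun.
From mathcomp Require Import ring lra.

Set Implicit Arguments.
Unset Strict Implicit.
Unset Printing Implicit Defensive.

Import Order.TTheory GRing.Theory Num.Theory.
Import numFieldNormedType.Exports.

Local Open Scope classical_set_scope.
Local Open Scope ring_scope.

(** Write Y for the observed path and F for its greatest convex minorant on
    [-1, 1], so that [fhat Y 0] is the left slope of F at 0.  If this slope
    exceeds c, then Y - c id cannot have its minimum over [-1, 1] on the
    positive side only: for each t in ]0, 1] some s in [-1, 0] satisfies
    Y(s) - c s <= Y(t) - c t ([fhat0_gt]).  The drift [F0] is nonnegative, so on
    the left Y(s) - c s is at least c |s| plus noise.  On the right, choose t with
    [F0 f t <= rho * b * t], where rho < 1 and c lies halfway between rho b and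
    b: then Y(t) - c t is below - (1 - rho) b t / 2 plus noise.  With r the
    square root of n, the event therefore forces W(t), or the supremum over u in
    [0, 1] of - W(- u) - r c u, to be of order r b t.  Both have probability at
    most a constant times exp(- kappa n b^2 t) ([fhat0_tail]).

    The hypothesis on [psi_r] says that G0 drops by a fixed factor when t is
    multiplied by a fixed s < 1 ([psi_r_contraction]).  So t = s G0^-1(b) is
    admissible for every small b, and n b^2 t is then s times the square of
    r H0(b).  For slopes up to [adelta] this gives a tail in C^2.  Above [adelta]
    the fixed time s G0^-1(adelta) is admissible for every b, [H0] is at most the
    identity, and the polynomial growth of chi turns the tail into one in
    C^(2/m).

    The supremum of a path with drift is controlled by the tails of single
    increments: a union bound over dyadic increments gives a Gaussian tail for
    the supremum over [0, T] ([mu_ext_sup_subgaussian]), and a second union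
    bound over T = 2^i x / mu handles the drift ([mu_ext_drift_subgaussian]).
    Working with the outer probability throughout avoids measurability questions
    about suprema and about [fhat]. *)

(** * The drift F0 and the inverse of G0 *)

Lemma nondecreasing_integrable (R : realType) (f : R -> R) :
  {in `[-1, 1] &, {homo f : x y / x <= y}} ->
  (@lebesgue_measure R).-integrable `[-1, 1] (EFin \o f).
Proof.
move=> f_nd.
have mf : measurable_fun (`[-1, 1]%classic : set R) f.
  (* Clamping the argument extends f monotonically to the whole line. *)
  pose g (x : R) := f (Num.max (-1) (Num.min 1 x)).
  apply: (@eq_measurable_fun _ _ _ _ _ g).
    move=> x; rewrite inE/= in_itv/= => /andP[x1 x2].
    by rewrite /g (min_r x2) (max_r x1).
  apply: nondecreasing_measurable => // x y xy; apply: f_nd.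
  - rewrite in_itv/= le_max lexx/= ge_max ge_min lexx/= andbT; lra.
  - rewrite in_itv/= le_max lexx/= ge_max ge_min lexx/= andbT; lra.
  - have le_min1 : Num.min 1 x <= Num.min 1 y.
      by rewrite le_min !ge_min lexx xy !orbT.
    by rewrite ge_max !le_max lexx le_min1 orbT.
apply: measurable_bounded_integrable => //.
  by rewrite /= lebesgue_measure_itv/= lte_fin; case: ifP => // _; rewrite -EFinD ltry.
exists (Num.max `|f (-1)| `|f 1|); split; first exact: num_real.
move=> M MM x /= ; rewrite in_itv/= => /andP[x1 x2].
have h1 : f (-1) <= f x by apply: f_nd => //; rewrite in_itv/=; lra.
have h2 : f x <= f 1 by apply: f_nd => //; rewrite in_itv/=; lra.
move: MM; rewrite gt_max => /andP[]; rewrite !ltr_norml => /andP[a1 a2] /andP[a3 a4].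
by rewrite ler_norml; apply/andP; split; lra.
Qed.

Lemma Rintegral_itv_bounds (R : realType) (f : R -> R) (s t : R) :
  {in `[-1, 1] &, {homo f : x y / x <= y}} ->
  -1 <= s -> s <= t -> t <= 1 ->
  f s * (t - s) <= \int[lebesgue_measure]_(x in `[s, t]) f x <= f t * (t - s).
Proof.
move=> f_nd s1 st t1.
have fi := nondecreasing_integrable f_nd.
have fst : (@lebesgue_measure R).-integrable `[s, t] (EFin \o f).
  apply: (integrableS _ _ _ fi) => // x /=; rewrite !in_itv/=; lra.
have mst : lebesgue_measure (`[s, t]%classic : set R) = (t - s)%:E.
  rewrite lebesgue_measure_itv/= lte_fin -EFinD.
  by case: ltP => // ts; rewrite (_ : t = s) ?subrr//; lra.
have cst_int (c : R) : (@lebesgue_measure R).-integrable `[s, t] (EFin \o cst c).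
  apply: measurable_bounded_integrable => //.
    by apply: (@eq_ind _ (t - s)%:E (fun z => (z < +oo)%E)) => //; exact: ltry.
  by exists `|c|; split; [exact: num_real|move=> M cM x _; exact: ltW].
have cstE (c : R) : \int[lebesgue_measure]_(x in `[s, t]) (cst c x) = c * (t - s).
  by rewrite Rintegral_cst//; congr (_ * _); exact: (congr1 fine mst).
rewrite -!cstE; apply/andP; split; apply: le_Rintegral => //= x;
  rewrite in_itv/= => /andP[x1 x2]; apply: f_nd => //; rewrite in_itv/=; lra.
Qed.

Lemma F0_0 (R : realType) (f : R -> R) : F0 f 0 = 0.
Proof. by rewrite /F0 lexx set_itv1 Rintegral_set1. Qed.

Lemma F0_increment (R : realType) (f : R -> R) (s t : R) :
  {in `[-1, 1] &, {homo f : x y / x <= y}} ->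
  -1 <= s -> s <= t -> t <= 1 ->
  f s * (t - s) <= F0 f t - F0 f s <= f t * (t - s).
Proof.
move=> f_nd.
have fi := nondecreasing_integrable f_nd.
have sub (a b : R) : -1 <= a -> b <= 1 ->
    (@lebesgue_measure R).-integrable `[a, b] (EFin \o f).
  by move=> a1 b1; apply: (integrableS _ _ _ fi) => // x /=; rewrite !in_itv/=; lra.
have pos (a b : R) : 0 <= a -> a <= b -> b <= 1 ->
    F0 f b - F0 f a = \int[lebesgue_measure]_(x in `[a, b]) f x.
  move=> a0 ab b1; rewrite /F0 a0 (le_trans a0 ab).
  rewrite Rintegral_itvB ?bnd_simp//; last by apply: sub => //; lra.
  rewrite Rintegral_itv_obnd_cbnd//; apply: (integrableS _ _ _ fi) => // x /=.
  by rewrite !in_itv/=; lra.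
have neg (a b : R) : -1 <= a -> a <= b -> b <= 0 ->
    F0 f b - F0 f a = \int[lebesgue_measure]_(x in `[a, b]) f x.
  move=> a1 ab b0.
  have E (c : R) : c <= 0 -> F0 f c = - \int[lebesgue_measure]_(x in `[c, 0]) f x.
    rewrite le_eqVlt => /predU1P[->|c0]; last by rewrite /F0 leNgt c0.
    by rewrite F0_0 set_itv1 Rintegral_set1 oppr0.
  rewrite !E//; last lra.
  rewrite opprK addrC.
  have := @Rintegral_itvB R f (BLeft a) (BRight 0) b.
  rewrite !bnd_simp => /(_ (sub _ _ a1 (ler01)) ab b0).
  rewrite Rintegral_itv_obnd_cbnd; first lra.
  apply: (integrableS _ _ _ fi) => // x /=.
  by rewrite !in_itv/=; lra.
move=> s1 st t1.
have [s0|s0] := leP 0 s; first by rewrite pos//; exact: Rintegral_itv_bounds.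
have [t0|t0] := leP t 0; first by rewrite neg//; exact: Rintegral_itv_bounds.
have /andP[a1 a2] := Rintegral_itv_bounds f_nd s1 (ltW s0) ler01.
have /andP[b1 b2] := Rintegral_itv_bounds f_nd (lerN10 _) (ltW t0) t1.
have h1 : f s <= f 0 by apply: f_nd; rewrite ?in_itv/=; lra.
have h2 : f 0 <= f t by apply: f_nd; rewrite ?in_itv/=; lra.
have := pos 0 t (lexx _) (ltW t0) t1; have := neg s 0 s1 (ltW s0) (lexx _).
by move=> E1 E2; apply/andP; split; nra.
Qed.

Lemma F0_ge0 (R : realType) (f : R -> R) (t : R) :
  {in `[-1, 1] &, {homo f : x y / x <= y}} -> f 0 = 0 ->
  -1 <= t <= 1 -> 0 <= F0 f t.
Proof.
move=> f_nd f00 /andP[t1 t2]; have [t0|t0] := leP 0 t.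
  have /andP[] := F0_increment f_nd (lerN10 _) t0 t2.
  by rewrite f00 mul0r F0_0; lra.
have /andP[] := F0_increment f_nd t1 (ltW t0) ler01.
by rewrite f00 mul0r F0_0; lra.
Qed.

Lemma F0_continuous (R : realType) (f : R -> R) :
  {in `[-1, 1] &, {homo f : x y / x <= y}} ->
  {within `[-1, 1], continuous (F0 f)}.
Proof.
move=> f_nd.
pose M := `|f (-1)| + `|f 1| + 1.
have M0 : 0 < M by rewrite /M ltr_wpDl// addr_ge0.
have fM (x : R) : -1 <= x <= 1 -> `|f x| <= M.
  move=> x1.
  have h1 : f (-1) <= f x by apply: f_nd; rewrite ?in_itv/=; lra.
  have h2 : f x <= f 1 by apply: f_nd; rewrite ?in_itv/=; lra.
  have := ler_norm (f 1); have := ler_norm (- f (-1)); rewrite normrN => a1 a2.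
  have := normr_ge0 (f 1); have := normr_ge0 (f (-1)) => a3 a4.
  by rewrite /M ler_norml; apply/andP; split; lra.
have lip (s t : R) : -1 <= s -> s <= t -> t <= 1 -> `|F0 f t - F0 f s| <= M * (t - s).
  move=> s1 st t1; have /andP[a1 a2] := F0_increment f_nd s1 st t1.
  have := fM s ltac:(lra); have := fM t ltac:(lra).
  rewrite !ler_norml => /andP[b1 b2] /andP[b3 b4].
  by apply/andP; split; nra.
apply/subspace_continuousP => x; rewrite /= in_itv/= => /andP[x1 x2].
apply/cvgrPdist_lt => e e0.
apply: (@filterS2 _ (within `[-1, 1] (nbhs x)) _
  (fun y => `|x - y| < e / M) (fun y => -1 <= y <= 1)).
- move=> y; rewrite ltr_norml => /andP[xy1 xy2] /andP[y1 y2].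
  have Me : e = M * (e / M) by rewrite mulrC divfK ?gt_eqF.
  have [xy|/ltW xy] := leP x y.
    by rewrite distrC; apply: (le_lt_trans (lip _ _ x1 xy y2)); rewrite [ltRHS]Me ltr_pM2l//; lra.
  by apply: (le_lt_trans (lip _ _ y1 xy x2)); rewrite [ltRHS]Me ltr_pM2l//; lra.
- rewrite /within/=; apply/nbhs_ballP; exists (e / M) => /=; first exact: divr_gt0.
  by move=> y.
- by rewrite /within/=; apply: nearW => y; rewrite /= in_itv.
Qed.

(** [G0 f t] is the mean of the nondecreasing f over [0, t]. *)
Lemma G0_le (R : realType) (f : R -> R) (s t : R) :
  {in `[-1, 1] &, {homo f : x y / x <= y}} ->
  0 < s -> s <= t -> t <= 1 -> G0 f s <= G0 f t.
Proof.
move=> f_nd s0 st t1; rewrite /G0 ler_pdivrMr// mulrAC ler_pdivlMr; last lra.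
have s1 : s <= 1 := le_trans st t1.
have s_ge : -1 <= s by lra.
have /andP[_] := F0_increment f_nd (lerN10 _) (ltW s0) s1.
have /andP[+ _] := F0_increment f_nd s_ge st t1.
by rewrite F0_0 !subr0 => a1 a2; nra.
Qed.

(** [G0 f t] is at most [f t], which vanishes with t;
    the intermediate value theorem then makes [G0inv] a right inverse of [G0]
    on ]0, F0 f 1]. *)
Lemma G0invP (R : realType) (f : R -> R) (b : R) :
  {in `[-1, 1] &, {homo f : x y / x <= y}} -> f 0 = 0 ->
  {for 0, continuous f} -> 0 < b -> b <= F0 f 1 ->
  0 < G0inv f b <= 1 /\ G0 f (G0inv f b) = b.
Proof.
move=> f_nd f00 fc b0 b1.
have [u [u0 u1 fu]] : exists u, [/\ 0 < u, u <= 1 & F0 f u < b * u].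
  have [e /= e0 He] : \forall x \near (0 : R), `|f 0 - f x| < b.
    by move/cvgrPdist_lt: fc => /(_ b b0).
  pose u := Num.min 1 (e / 2).
  have u0 : 0 < u by rewrite lt_min ltr01 divr_gt0.
  have u1 : u <= 1 by rewrite ge_min lexx.
  have ue : u < e by rewrite gt_min; apply/orP; right; lra.
  exists u; split => //.
  have /andP[_] := F0_increment f_nd (lerN10 _) (ltW u0) u1.
  rewrite F0_0 !subr0 => /le_lt_trans; apply; rewrite ltr_pM2r//.
  have := He u; rewrite /ball/= sub0r normrN gtr0_norm// => /(_ ue).
  by rewrite f00 sub0r normrN => /(le_lt_trans (ler_norm _)).
have [c cu fcc] : exists2 c, c \in `[u, 1] & F0 f c - b * c = 0.
  apply: IVT => //.
    have sub : `[u, 1]%classic `<=` (`[-1, 1]%classic : set R).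
      by move=> x /=; rewrite !in_itv/=; lra.
    have Fc := continuous_subspaceW sub (F0_continuous f_nd).
    have lin : {within `[u, 1], continuous (fun s : R => b * s)}.
      by apply: continuous_subspaceT; exact: mulrl_continuous.
    by move=> x; apply: cvgB; [exact: Fc|exact: lin].
  by rewrite ge_min le_max; apply/andP; split; apply/orP; [left|right]; lra.
move: cu; rewrite in_itv/= => /andP[uc c1].
pose A := [set t : R | 0 < t <= 1 /\ 0 < F0 f t].
have c0 : 0 < c by lra.
have imb : b \in G0 f @` A.
  rewrite inE; exists c.
    by split; [rewrite c0 c1 | have := mulr_gt0 b0 c0; lra].
  by rewrite /G0 (_ : F0 f c = b * c) ?mulfK ?gt_eqF//; lra.
rewrite /G0inv gt_eqF//; split; last by rewrite pinvK.
by have [] : A ('pinv_(fun=> 0) A (G0 f) b) by apply: funS; rewrite -inE.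
Qed.

(** * Slope of the greatest convex minorant at 0 *)

Lemma Fhat_ge (R : realType) (y : R -> R) (a b t : R) :
  (forall s, -1 <= s <= 1 -> a * s + b <= y s) -> -1 <= t <= 1 ->
  a * t + b <= Fhat y t.
Proof.
move=> ab t1; apply: ub_le_sup.
  by exists (y t) => _ [phi [_ phiy] <-]; exact: phiy.
by exists (fun s => a * s + b) => //; split => //; exists a, b.
Qed.

Lemma Fhat_le (R : realType) (y : R -> R) (a0 b0 t M : R) :
  (forall s, -1 <= s <= 1 -> a0 * s + b0 <= y s) ->
  (forall a b, (forall s, -1 <= s <= 1 -> a * s + b <= y s) -> a * t + b <= M) ->
  Fhat y t <= M.
Proof.
move=> ab0 leM; apply: ge_sup.
  by exists (a0 * t + b0), (fun s => a0 * s + b0) => //; split => //; exists a0, b0.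
move=> _ [phi [[a [b phiE]] phiy] <-]; rewrite phiE; apply: leM => s s1.
by rewrite -phiE; exact: phiy.
Qed.

(** The limit of a divergent quotient is 0 by convention; [0 <= c] covers that
    case. *)
Lemma fhat0_le (R : realType) (y : R -> R) (c : R) : 0 <= c ->
  (forall h, 0 < h <= 1 -> Fhat y 0 - Fhat y (0 - h) <= c * h) ->
  fhat y 0 <= c.
Proof.
move=> c0 slope; rewrite /fhat.
set g := (X in lim X).
have [cg|/dvgP->//] := pselect (cvg g).
apply: limr_le => //.
near=> h.
have h0 : 0 < h by [].
rewrite ler_pdivrMr//; apply: slope; rewrite h0/=.
near: h; exact: nbhs_right_le.
Unshelve. all: by end_near.
Qed.

(** Suppose that no s fits some t.  Then the minimum of y - c id over [-1, 1], say m, is attained only at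
    points u > 0.  The line of slope c and intercept m lies below y, so the
    minorant is at least m - c h at - h.  An affine minorant of slope at most c
    loses at most c h from 0 to - h; a steeper one lies below y at u, hence below
    m at 0.  So the left quotients at 0 are at most c. *)
Lemma fhat0_gt (R : realType) (y : R -> R) (c t : R) :
  {within `[-1, 1], continuous y} -> 0 <= c -> c < fhat y 0 -> 0 < t <= 1 ->
  exists2 s, -1 <= s <= 0 & y s - c * s <= y t - c * t.
Proof.
move=> y_cont c0 cf t1; apply: contrapT => no_s.
have left_gt s : -1 <= s <= 0 -> y t - c * t < y s - c * s.
  by move=> s1; rewrite ltNge; apply/negP => ?; apply: no_s; exists s.
have lin : {within `[-1, 1], continuous (fun s : R => c * s)}.
  by apply: continuous_subspaceT; exact: mulrl_continuous.
have [u u1 umin] : exists2 u, u \in `[-1, 1] &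
    forall s, s \in `[-1, 1] -> y u - c * u <= y s - c * s.
  apply: EVT_min; first lra.
  move=> x; apply: cvgB; first exact: y_cont.
  exact: lin.
have u0 : 0 < u.
  rewrite ltNge; apply/negP => u0; move: u1; rewrite in_itv/= => /andP[u1 _].
  have := left_gt u ltac:(lra); have := umin t; rewrite in_itv/= => /(_ ltac:(lra)).
  lra.
have minor s : -1 <= s <= 1 -> c * s + (y u - c * u) <= y s.
  by move=> s1; have := umin s; rewrite in_itv/= => /(_ s1); lra.
suff : fhat y 0 <= c by lra.
apply: fhat0_le => // h h1; rewrite lerBlDl.
have := Fhat_ge minor (t := 0 - h) ltac:(lra) => Fh.
apply: (Fhat_le minor) => a b ab.
have [ac|ca] := leP a c.
  have := Fhat_ge ab (t := 0 - h) ltac:(lra); nra.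
have := ab u; move: u1; rewrite in_itv/= => u1 /(_ u1).
nra.
Qed.

(** * Suprema of paths with Gaussian increment tails *)

(** Halving the index leads from a point of level N + 1 to a point of level N, by
    one forward increment of level N + 1 when the index is odd and by none when
    it is even. *)
Lemma dyadic_chain (R : realType) (g : R -> R) (T : R) (D : nat -> R) :
  (forall j, 0 <= D j) ->
  (forall j k, (k < 2 ^ j)%N ->
    g (k.+1%:R * T / 2 ^+ j) - g (k%:R * T / 2 ^+ j) <= D j) ->
  forall N k, (k <= 2 ^ N)%N -> g (k%:R * T / 2 ^+ N) <= g 0 + \sum_(j < N.+1) D j.
Proof.
move=> D0 incr; elim=> [|N IH] k kN.
  rewrite big_ord1; case: k kN => [|[|//]] _; first by rewrite !mul0r lerDl.
  by have := incr 0%N 0%N isT; rewrite !mul0r; lra.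
rewrite big_ord_recr/= -{1}(odd_double_half k).
have half_eq m : (m.*2)%:R * T / 2 ^+ N.+1 = m%:R * T / 2 ^+ N.
  by rewrite -mul2n natrM exprS; field; rewrite expf_neq0.
have half_le : (k./2 <= 2 ^ N)%N by rewrite leq_half_double -mul2n -expnS leqW.
have := IH _ half_le; have := D0 N.+1.
case: (boolP (odd k)) => ok; last by rewrite add0n half_eq; lra.
have k_lt : (k./2.*2 < 2 ^ N.+1)%N by move: kN; rewrite -{1}(odd_double_half k) ok.
by have := incr N.+1 _ k_lt; rewrite half_eq add1n; lra.
Qed.

Lemma dyadic_dense_le (R : realType) (g : R -> R) (T M : R) :
  {within `[0, 1], continuous g} -> 0 < T <= 1 ->
  (forall N k, (k <= 2 ^ N)%N -> g (k%:R * T / 2 ^+ N) <= M) ->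
  forall t, 0 <= t <= T -> g t <= M.
Proof.
move=> g_cont /andP[T0 T1] gM t /andP[t0 tT]; rewrite leNgt; apply/negP => Mg.
have t1 : (`[0, 1]%classic : set R) t by rewrite /= in_itv/=; lra.
have /subspace_continuousP/(_ _ t1)/cvgrPdist_lt/(_ (g t - M)) := g_cont.
rewrite subr_gt0 => /(_ Mg)/nbhs_ballP[e /= e0 He].
pose N := (Num.truncn e^-1).+1.
have N2 : e^-1 < 2 ^+ N.
  apply: (lt_trans (truncnS_gt _)); rewrite -natrX ltr_nat; exact: ltn_expl.
have P2 : (0 : R) < 2 ^+ N by rewrite exprn_gt0.
pose k := Num.truncn (t * 2 ^+ N / T).
have q0 : 0 <= t * 2 ^+ N / T by rewrite divr_ge0 ?mulr_ge0// ltW.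
have /andP[k1 k2] := truncn_itv q0.
rewrite -/k in k1 k2.
have kN : (k <= 2 ^ N)%N.
  rewrite -(ler_nat R) (le_trans k1)// natrX ler_pdivrMr// mulrC.
  by rewrite ler_pM2l.
have xt : k%:R * T / 2 ^+ N <= t.
  by rewrite ler_pdivrMr// -ler_pdivlMr.
have xt2 : t < k%:R * T / 2 ^+ N + T / 2 ^+ N.
  rewrite -mulrDl -[X in _ + X]mul1r -mulrDl natr1.
  by rewrite ltr_pdivlMr// -ltr_pdivrMr.
have Te : T / 2 ^+ N < e.
  rewrite ltr_pdivrMr//; apply: (le_lt_trans T1).
  by rewrite -ltr_pdivrMl// mulr1.
have x0 : 0 <= k%:R * T / 2 ^+ N by rewrite divr_ge0 ?mulr_ge0// ltW.
have := He (k%:R * T / 2 ^+ N); rewrite /ball/= ger0_norm ?subr_ge0//.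
rewrite in_itv/= => /(_ ltac:(lra) ltac:(lra)).
have := gM N k kN => h1; rewrite ltr_norml => /andP[_].
by move=> h2; move: h1; rewrite leNgt => /negP; apply; move: h2; rewrite /from_subspace; lra.
Qed.

(** The thresholds x (3/4)^j / 4 sum to x.  The ratio 3/4 is chosen because
    2 (3/4)^2 > 1: relative to the standard deviation of a dyadic increment, the
    threshold grows with the level. *)
Lemma sup_of_dyadic_increments (R : realType) (g : R -> R) (T x : R) :
  {within `[0, 1], continuous g} -> 0 < T <= 1 -> 0 < x ->
  (forall j k, (k < 2 ^ j)%N ->
    g (k.+1%:R * T / 2 ^+ j) - g (k%:R * T / 2 ^+ j) <= x * (3 / 4) ^+ j / 4) ->
  forall t, 0 <= t <= T -> g t <= g 0 + x.
Proof.
move=> g_cont T1 x0 incr; apply: dyadic_dense_le => // N k kN.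
have D0 j : 0 <= x * (3 / 4) ^+ j / 4.
  by rewrite divr_ge0// mulr_ge0 ?ltW// exprn_ge0//; lra.
apply: (le_trans (dyadic_chain D0 incr kN)); rewrite lerD2l.
have -> : \sum_(j < N.+1) x * (3 / 4) ^+ j / 4 = x * (1 - (3 / 4) ^+ N.+1).
  elim: N.+1 => [|n IH]; first by rewrite big_ord0 expr0 subrr mulr0.
  by rewrite big_ord_recr/= IH exprS; field.
by rewrite ler_piMr ?(ltW x0)// gerBl exprn_ge0//; lra.
Qed.

(** Only the upper tail is bounded, in the form satisfied by a centred Gaussian
    increment of variance t - s. *)
Definition subgaussian_increments (R : realType) (d : measure_display)
    (T : measurableType d) (P : probability T R) (Z : R -> T -> R) : Prop :=
  forall s t c : R, 0 <= s -> s < t -> t <= 1 -> 0 <= c ->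
  (mu_ext P [set w | (c <= Z t w - Z s w)%R] <=
   (expR (- (c ^+ 2 / (2 * (t - s)))))%:E)%E.

Definition continuous_from0 (R : realType) (g : R -> R) : Prop :=
  {within `[0, 1], continuous g} /\ g 0 = 0.

Lemma mu_ext_le1 (R : realType) (d : measure_display) (T : measurableType d)
    (P : probability T R) (A : set T) : (mu_ext P A <= 1)%E.
Proof.
apply: (@le_trans _ _ (mu_ext P setT)); first exact: le_mu_ext.
by rewrite measurable_mu_extE//; exact: probability_le1.
Qed.

Lemma mu_ext_bigcup_halving (R : realType) (d : measure_display)
    (T : measurableType d) (P : probability T R) (F : nat -> set T) (c : R) :
  0 <= c -> (forall i, (mu_ext P (F i) <= (c / 2 ^+ i)%:E)%E) ->
  (mu_ext P (\bigcup_i F i) <= (2 * c)%:E)%E.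
Proof.
move=> c0 Fc; apply: (le_trans (outer_measure_sigma_subadditive (mu_ext P) F)).
have c2 : 0 <= 2 * c by rewrite mulr_ge0.
apply: (le_trans _ (epsilon_trick0 xpredT c2)).
apply: lee_nneseries => [i _ _|i _]; first exact: (outer_measure_ge0 (mu_ext P)).
have -> : 2 * c / (2 ^ i.+1)%:R = c / 2 ^+ i.
  by rewrite natrX exprS; field; rewrite expf_neq0.
exact: Fc.
Qed.

Lemma expR_le_geometric (R : realType) (a : R) (i : nat) (y : R) :
  i.+1%:R * a <= y -> expR (- y) <= expR (- a) ^+ i.+1.
Proof. by move=> ay; rewrite -expRM_natl ler_expR mulrN lerN2. Qed.

(** Chaining: at level j there are 2^j increments, each exceeding its threshold
    with probability at most exp(- x^2 (9/8)^j / (32 T0)).  Since (9/8)^j is at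
    least (j + 1) / 8, this is at most q^(j+1) with q the exponential in the
    conclusion, and the levels sum geometrically once q <= 1/4.  For larger q the
    bound exceeds 1. *)
Lemma mu_ext_sup_subgaussian (R : realType) (d : measure_display)
    (T : measurableType d) (P : probability T R) (Z : R -> T -> R) (T0 x : R) :
  subgaussian_increments P Z -> 0 < T0 <= 1 -> 0 < x ->
  (mu_ext P [set w | continuous_from0 (Z ^~ w) /\
                     exists2 t, 0 <= t <= T0 & x < Z t w]%R <=
   (4 * expR (- (x ^+ 2 / (256 * T0))))%:E)%E.
Proof.
move=> Zsub /andP[T00 T01] x0; set a := x ^+ 2 / (256 * T0); set q := expR (- a).
have a0 : 0 < a by apply: divr_gt0; [exact: exprn_gt0|lra].
have q0 : 0 < q by exact: expR_gt0.
have [q4|q4] := leP q (1 / 4); last first.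
  by apply: (le_trans (mu_ext_le1 _ _)); rewrite lee_fin; lra.
pose D j : R := x * (3 / 4) ^+ j / 4.
pose E j k := [set w | (D j <= Z (k.+1%:R * T0 / 2 ^+ j) w - Z (k%:R * T0 / 2 ^+ j) w)%R].
pose B j := \bigcup_(k in `I_(2 ^ j)%N) E j k.
apply: (@le_trans _ _ (mu_ext P (\bigcup_j B j))).
  apply: le_mu_ext => w [[Zc Z0] [t tT xZ]]; apply: contrapT => notB.
  suff : Z t w <= Z 0 w + x by rewrite Z0; lra.
  apply: (@sup_of_dyadic_increments _ (Z ^~ w) T0) => //; first by rewrite T00.
  move=> j k kj; rewrite leNgt; apply/negP => /ltW Dk.
  by apply: notB; exists j => //; exists k.
apply: (@le_trans _ _ (2 * q)%:E); last by rewrite lee_fin; lra.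
apply: mu_ext_bigcup_halving => [|j]; first exact: ltW.
have pow2 : (0 : R) < 2 ^+ j by rewrite exprn_gt0.
have Ek k : (k < 2 ^ j)%N -> (mu_ext P (E j k) <= (q ^+ j.+1)%:E)%E.
  move=> kj; have D0 : 0 <= D j by rewrite divr_ge0// mulr_ge0 ?(ltW x0)// exprn_ge0//; lra.
  have step : k.+1%:R * T0 / 2 ^+ j - k%:R * T0 / 2 ^+ j = T0 / 2 ^+ j.
    by rewrite -natr1; field; rewrite gt_eqF.
  have h0 : 0 <= k%:R * T0 / 2 ^+ j by rewrite divr_ge0 ?mulr_ge0// ltW.
  have h1 : k.+1%:R * T0 / 2 ^+ j <= 1.
    rewrite ler_pdivrMr// mul1r -natrX.
    apply: (@le_trans _ _ k.+1%:R); last by rewrite ler_nat.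
    by rewrite ler_piMr.
  have hlt : k%:R * T0 / 2 ^+ j < k.+1%:R * T0 / 2 ^+ j.
    by rewrite -subr_gt0 step divr_gt0.
  apply: (le_trans (Zsub _ _ _ h0 hlt h1 D0)); rewrite lee_fin.
  apply: expR_le_geometric; rewrite step.
  have bernoulli : forall m : nat, 1 + m%:R / 8 <= (9 / 8) ^+ m :> R.
    elim=> [|m IH]; first by rewrite expr0 mul0r addr0.
    have m0 : 0 <= m%:R :> R by [].
    by rewrite exprS -natr1; lra.
  have -> : D j ^+ 2 / (2 * (T0 / 2 ^+ j)) = 8 * (9 / 8) ^+ j * a.
    have -> : (9 / 8 : R) ^+ j = (3 / 4) ^+ j * (3 / 4) ^+ j * 2 ^+ j.
      by rewrite -!exprMn; congr (_ ^+ _); field.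
    by rewrite /D /a; field; rewrite !gt_eqF.
  rewrite ler_pM2r// -natr1.
  by have := bernoulli j; have : 0 <= j%:R :> R by []; lra.
rewrite /B bigcup_mkord.
apply: (le_trans (outer_measure_subadditive (mu_ext P) _ _)).
apply: (@le_trans _ _ (\sum_(k < 2 ^ j) (q ^+ j.+1)%:E)%E).
  by apply: lee_sum => k _; exact: Ek.
rewrite sumEFin sumr_const card_ord lee_fin -[_ *+ _]mulr_natl natrX.
rewrite ler_pdivlMr// exprS mulrCA -mulrA ler_piMr ?(ltW q0)//.
rewrite mulrAC -!exprMn exprn_ile1//; nra.
Qed.

(** Peeling: for i > 0, a crossing of x + mu t at a time between
    2^(i-1) x / mu and 2^i x / mu makes Z exceed 2^i x / 2 there, an event of
    probability at most 4 exp(- 2^i x mu / 1024) by the bound on the supremum;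
    times up to x / mu are covered by i = 0. *)
Lemma mu_ext_drift_subgaussian (R : realType) (d : measure_display)
    (T : measurableType d) (P : probability T R) (Z : R -> T -> R) (x mu : R) :
  subgaussian_increments P Z -> 0 < x -> 0 < mu ->
  (mu_ext P [set w | continuous_from0 (Z ^~ w) /\
                     exists2 t, 0 <= t <= 1 & x + mu * t <= Z t w]%R <=
   (8 * expR (- (x * mu / 1024)))%:E)%E.
Proof.
move=> Zsub x0 mu0; set a := x * mu / 1024; set q := expR (- a).
have a0 : 0 < a by apply: divr_gt0; [exact: mulr_gt0|lra].
have q0 : 0 < q by exact: expR_gt0.
have [q2|q2] := leP q (1 / 2); last first.
  by apply: (le_trans (mu_ext_le1 _ _)); rewrite lee_fin; lra.
pose Tm i : R := Num.min 1 (2 ^+ i * x / mu).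
pose xm i : R := 2 ^+ i * x / 2.
have pow2 i : (0 : R) < 2 ^+ i by rewrite exprn_gt0.
pose S i := [set w | continuous_from0 (Z ^~ w) /\
                     exists2 t, 0 <= t <= Tm i & xm i < Z t w].
apply: (@le_trans _ _ (mu_ext P (\bigcup_i S i))).
  apply: le_mu_ext => w [Zw [t /andP[t0 t1] xZ]].
  have ex_i : exists i, t <= 2 ^+ i * x / mu.
    exists (Num.truncn (mu / x)).+1.
    rewrite (le_trans t1)// ler_pdivlMr// mul1r -ler_pdivrMr//.
    apply: (le_trans (ltW (truncnS_gt _))); rewrite -natrX ler_nat; exact/ltnW/ltn_expl.
  pose i := ex_minn ex_i; exists i => //; split => //; exists t.
    by rewrite t0 le_min t1 /i; case: ex_minnP.
  rewrite /xm /i; case: ex_minnP => -[|m] _ mmin; first by rewrite expr0; nra.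
  have : ~~ (t <= 2 ^+ m * x / mu) by apply/negP => /mmin; rewrite ltnn.
  by rewrite -ltNge ltr_pdivrMr// exprS => mt; lra.
apply: (@le_trans _ _ (2 * (4 * q))%:E); last by rewrite lee_fin; lra.
apply: mu_ext_bigcup_halving => [|i]; first by rewrite mulr_ge0// ltW.
have Tm0 : 0 < Tm i by rewrite lt_min ltr01 divr_gt0// mulr_gt0.
have Tm1 : Tm i <= 1 by rewrite ge_min lexx.
have Tmx : Tm i <= 2 ^+ i * x / mu by rewrite ge_min lexx orbT.
have xm0 : 0 < xm i by rewrite divr_gt0// mulr_gt0.
apply: (le_trans (@mu_ext_sup_subgaussian _ _ _ _ _ (Tm i) (xm i) Zsub _ xm0)).
  by rewrite Tm0.
rewrite lee_fin -mulrA ler_pM2l//.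
apply: (@le_trans _ _ (q ^+ i.+1)).
  apply: expR_le_geometric.
  apply: (@le_trans _ _ (2 ^+ i * a)).
    by rewrite ler_pM2r// -natrX ler_nat ltn_expl.
  rewrite ler_pdivlMr; last by lra.
  have -> : xm i ^+ 2 = 2 ^+ i * a * (256 * (2 ^+ i * x / mu)).
    by rewrite /xm /a; field; rewrite gt_eqF.
  rewrite ler_pM2l; last by apply: mulr_gt0.
  by lra.
rewrite ler_pdivlMr// exprS -mulrA ler_piMr ?(ltW q0)//.
by rewrite -exprMn exprn_ile1//; nra.
Qed.

(** * Two-sided Brownian motion *)

(** For u >= x the density at u is at most exp(- x^2 / (2 sigma^2)) times the
    density of the normal law centred at x, because u^2 - x^2 - (u - x)^2 =
    2 x (u - x) >= 0. *)
Lemma normal_prob_tail (R : realType) (sigma x : R) : 0 < sigma -> 0 <= x ->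
  (normal_prob 0 sigma `[x, +oo[ <= (expR (- (x ^+ 2 / (2 * sigma ^+ 2))))%:E)%E.
Proof.
move=> s0 x0; have s_neq0 : sigma != 0 by rewrite gt_eqF.
have mpdf m : measurable_fun (`[x, +oo[%classic : set R) (EFin \o normal_pdf m sigma).
  apply/measurable_EFinP; apply: (measurable_funS _ _ (measurable_normal_pdf _ _)) => //.
rewrite /normal_prob.
apply: (@le_trans _ _ (\int[lebesgue_measure]_(u in `[x, +oo[)
    ((expR (- (x ^+ 2 / (2 * sigma ^+ 2))))%:E * (normal_pdf x sigma u)%:E))%E).
  apply: ge0_le_integral => //=.
  - by move=> u _; rewrite lee_fin normal_pdf_ge0.
  - exact: mpdf.
  - by apply: emeasurable_funM => //; exact: mpdf.
  move=> u ux; have {ux} : (`[x, +oo[%classic : set R) u by exact: ux.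
  rewrite /= in_itv/= andbT => xu.
  rewrite -EFinM lee_fin !normal_pdfE// mulrCA ler_wpM2l ?normal_peak_ge0//.
  rewrite /normal_fun -expRD ler_expR subr0 -[sigma ^+ 2 *+ 2]mulr_natl.
  rewrite -subr_ge0.
  rewrite [leRHS](_ : _ = (x * (u - x)) / (sigma ^+ 2)); last by field.
  by rewrite divr_ge0 ?sqr_ge0// mulr_ge0// subr_ge0.
rewrite ge0_integralZl//=; last 2 first.
- exact: mpdf.
- by move=> u _; rewrite lee_fin normal_pdf_ge0.
rewrite -[leRHS]mule1; apply: lee_pmul => //.
- by apply: integral_ge0 => u _; rewrite lee_fin normal_pdf_ge0.
exact: (@probability_le1 _ _ _ (normal_prob x sigma)).
Qed.

Lemma brownian_increment_tail (R : realType) (d : measure_display)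
    (T : measurableType d) (P : probability T R) (W : R -> {RV P >-> R})
    (s t c : R) :
  two_sided_brownian W -> -1 <= s -> s < t -> t <= 1 -> 0 <= c ->
  (mu_ext P [set w | (c <= W t w - W s w)%R] <=
   (expR (- (c ^+ 2 / (2 * (t - s)))))%:E)%E.
Proof.
move=> [_ _ incr _] s1 st t1 c0.
have mW : measurable [set w | c <= W t w - W s w].
  have : measurable_fun setT (fun w => W t w - W s w) by exact: measurable_funB.
  move=> /(_ measurableT _ (measurable_itv `[c, +oo[)); rewrite setTI.
  by congr (measurable _); apply/seteqP; split => w /=; rewrite in_itv/= andbT.
have PW : P [set w | c <= W t w - W s w] =
    normal_prob 0 (Num.sqrt (t - s)) `[c, +oo[.
  rewrite -(incr s t s1 st t1 _ (measurable_itv `[c, +oo[)); congr (P _).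
  by apply/seteqP; split => w /=; rewrite in_itv/= andbT.
rewrite measurable_mu_extE// [leLHS]PW.
apply: (le_trans (normal_prob_tail _ c0)); first by rewrite sqrtr_gt0 subr_gt0.
by rewrite sqr_sqrtr// subr_ge0 ltW.
Qed.

(** An increment of - W(-u) is a forward increment of W on the negative side. *)
Lemma reversed_brownian_subgaussian (R : realType) (d : measure_display)
    (T : measurableType d) (P : probability T R) (W : R -> {RV P >-> R}) :
  two_sided_brownian W ->
  subgaussian_increments P (fun u w => - W (- u) w).
Proof.
move=> BW s t c s0 st t1 c0.
have := @brownian_increment_tail _ _ _ _ _ (- t) (- s) c BW.
rewrite opprK (addrC (- s)) ltrN2 lerN2 => /(_ t1 st _ c0) /=.
rewrite (_ : [set w | c <= - W (- t) w - - W (- s) w] =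
  [set w | c <= W (- s) w - W (- t) w]); first by apply; lra.
by apply/seteqP; split => w /=; rewrite opprK addrC.
Qed.

Lemma reversed_path_continuous (R : realType) (d : measure_display)
    (T : measurableType d) (P : probability T R) (W : R -> {RV P >-> R}) (w : T) :
  W 0 w = 0 -> {within `[-1, 1], continuous (fun t => W t w)} ->
  continuous_from0 (fun u => - W (- u) w).
Proof.
move=> W0 Wc; split; last by rewrite oppr0 W0 oppr0.
apply/subspace_continuousP => x; rewrite /= in_itv/= => /andP[x0 x1].
apply/cvgrPdist_lt => e e0.
have x1' : (`[-1, 1]%classic : set R) (- x) by rewrite /= in_itv/=; lra.
have /subspace_continuousP/(_ _ x1')/cvgrPdist_lt/(_ e e0) := Wc.
move=> /nbhs_ballP[r /= r0 Hr]; rewrite /within/=; apply/nbhs_ballP; exists r => //.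
move=> y /= xy; rewrite in_itv/= => /andP[y0 y1].
have := Hr (- y); rewrite /ball/= opprK addrC -normrN opprD opprK addrC.
rewrite in_itv/= => /(_ xy ltac:(lra)).
by rewrite /from_subspace -normrN opprD.
Qed.

Lemma mu_ext_ae_le0 (R : realType) (d : measure_display) (T : measurableType d)
    (P : probability T R) (Q : T -> Prop) :
  {ae P, forall w, Q w} -> (mu_ext P [set w | ~ Q w] <= 0)%E.
Proof.
move=> [A [mA PA QA]].
by rewrite -PA -(measurable_mu_extE P mA); exact: le_mu_ext.
Qed.

(** * Tail of the estimator *)

Lemma Yobs_continuous (R : realType) (f : R -> R) (d : measure_display)
    (T : measurableType d) (P : probability T R) (W : R -> {RV P >-> R})
    (n : nat) (w : T) :
  {in `[-1, 1] &, {homo f : x y / x <= y}} ->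
  {within `[-1, 1], continuous (fun t => W t w)} ->
  {within `[-1, 1], continuous (Yobs f n W w)}.
Proof.
move=> f_nd Wc x; apply: cvgD; first exact: (F0_continuous f_nd).
by apply: cvgM; [exact: cvg_cst|exact: Wc].
Qed.

(** The slack [2 * e * t] of the drift at t is shared equally between the noise at
    t and the noise on the left of 0; u is minus the point supplied by
    [fhat0_gt]. *)
Lemma fhat0_crossing (R : realType) (f : R -> R) (d : measure_display)
    (T : measurableType d) (P : probability T R) (W : R -> {RV P >-> R})
    (n : nat) (w : T) (c e t : R) :
  {in `[-1, 1] &, {homo f : x y / x <= y}} -> f 0 = 0 -> (0 < n)%N ->
  {within `[-1, 1], continuous (fun t => W t w)} ->
  0 <= c -> 0 < t <= 1 -> F0 f t <= (c - 2 * e) * t ->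
  c < fhat (Yobs f n W w) 0 ->
  Num.sqrt n%:R * (e * t) <= W t w \/
  exists2 u, 0 <= u <= 1 &
    Num.sqrt n%:R * (e * t) + Num.sqrt n%:R * c * u <= - W (- u) w.
Proof.
move=> f_nd f00 n0 Wc c0 t1 Ft cf.
have Yc := @Yobs_continuous _ _ _ _ _ _ n _ f_nd Wc.
have [s s1] := fhat0_gt Yc c0 cf t1.
rewrite /Yobs => le_st.
set r := Num.sqrt n%:R in le_st *.
have r0 : 0 < r by rewrite sqrtr_gt0 ltr0n.
have Fs : 0 <= F0 f s by apply: F0_ge0 => //; lra.
have key : W s w - r * c * s <= W t w - 2 * (r * (e * t)).
  have : r^-1 * W s w - c * s <= r^-1 * W t w - 2 * (e * t) by lra.
  rewrite -(ler_pM2l r0) !mulrBr !mulrA divff ?gt_eqF// !mul1r.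
  by rewrite (mulrC r 2) -!mulrA.
have [Wt|/ltW Wt] := leP (r * (e * t)) (W t w); [by left|right].
by exists (- s); [lra|rewrite opprK mulrN; lra].
Qed.

(** The slope c = (1 + rho) b / 2 exceeds rho b by (1 - rho) b / 2 = 2 e.  Taking
    it below b allows for the strict inequality in [fhat0_gt] at the
    cost of a constant only. *)
Lemma fhat0_tail (R : realType) (f : R -> R) (d : measure_display)
    (T : measurableType d) (P : probability T R) (W : R -> {RV P >-> R})
    (n : nat) (b rho t : R) :
  {in `[-1, 1] &, {homo f : x y / x <= y}} -> f 0 = 0 -> (0 < n)%N ->
  two_sided_brownian W ->
  0 < b -> 0 < rho < 1 -> 0 < t <= 1 -> F0 f t <= rho * b * t ->
  (mu_ext P [set w | ((1 + rho) / 2 * b < fhat (Yobs f n W w) 0)%R] <=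
   (9 * expR (- ((1 - rho) ^+ 2 / 8192 * (n%:R * b ^+ 2 * t))))%:E)%E.
Proof.
move=> f_nd f00 n0 BW b0 /andP[rho0 rho1] /andP[t0 t1] Ft.
set q := expR _.
pose r : R := Num.sqrt n%:R.
have r0 : 0 < r by rewrite sqrtr_gt0 ltr0n.
have rr : r ^+ 2 = n%:R by rewrite sqr_sqrtr.
pose c := (1 + rho) / 2 * b; pose e := (1 - rho) / 4 * b.
have c0 : 0 < c by rewrite /c; clear -b0 rho0; apply: mulr_gt0; lra.
have e0 : 0 < e by rewrite /e; clear -b0 rho1; apply: mulr_gt0; lra.
pose D := r * (e * t).
have D0 : 0 < D := mulr_gt0 r0 (mulr_gt0 e0 t0).
have [W0 Wc _ _] := BW.
pose A1 := [set w | D <= W t w - W 0 w].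
pose A2 := [set w | continuous_from0 (fun u => - W (- u) w) /\
                    exists2 u, 0 <= u <= 1 & D + r * c * u <= - W (- u) w].
pose N1 := [set w | ~ W 0 w = 0].
pose N2 := [set w | ~ {within `[-1, 1], continuous (fun t => W t w)}].
apply: (@le_trans _ _ (mu_ext P ((N1 `|` N2) `|` (A1 `|` A2)))).
  apply: le_mu_ext => w /= cf.
  have [w0|] := pselect (W 0 w = 0); last by left; left.
  have [wc|] := pselect {within `[-1, 1], continuous (fun t => W t w)}; last by left; right.
  have Fce : F0 f t <= (c - 2 * e) * t.
    by rewrite (le_trans Ft)// /c /e; lra.
  right; case: (fhat0_crossing f_nd f00 n0 wc (ltW c0) _ Fce cf).
  - by rewrite t0.
  - by move=> Wt; left; rewrite /A1 /= w0 subr0.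
  - by move=> cross; right; split => //; exact: reversed_path_continuous.
have n_r : (n%:R * b ^+ 2 * t) = (r * b) ^+ 2 * t by rewrite exprMn rr.
apply: (le_trans (outer_measureU2 (mu_ext P) _ _)).
have -> : (9 * q)%:E = (0 + (q + 8 * q)%:E)%E by rewrite add0e; congr _%:E; ring.
apply: leeD.
  apply: (le_trans (outer_measureU2 (mu_ext P) _ _)).
  rewrite -[leRHS]adde0; apply: leeD; [exact: mu_ext_ae_le0 W0|].
  exact: mu_ext_ae_le0 Wc.
apply: (le_trans (outer_measureU2 (mu_ext P) _ _)); rewrite EFinD; apply: leeD.
  apply: (le_trans (brownian_increment_tail BW (lerN10 _) t0 t1 (ltW D0))).
  rewrite lee_fin ler_expR lerN2 subr0.
  have -> : D ^+ 2 / (2 * t) = (1 - rho) ^+ 2 / 32 * ((r * b) ^+ 2 * t).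
    by rewrite /D /e; field; rewrite gt_eqF.
  rewrite n_r; apply: ler_wpM2r; first by rewrite mulr_ge0 ?sqr_ge0// ltW.
  have := sqr_ge0 (1 - rho); lra.
have rc0 : 0 < r * c by rewrite mulr_gt0.
apply: (le_trans (mu_ext_drift_subgaussian (reversed_brownian_subgaussian BW) D0 rc0)).
rewrite lee_fin; apply: ler_wpM2l; first by rewrite ler0n.
rewrite ler_expR lerN2.
have -> : D * (r * c) / 1024 = (1 - rho) * (1 + rho) / 8192 * ((r * b) ^+ 2 * t).
  by rewrite /D /e /c; field.
rewrite n_r; apply: ler_wpM2r; first by rewrite mulr_ge0 ?sqr_ge0// ltW.
nra.
Qed.

(** * Scaling of G0 and growth of H0 *)

(** If F0 vanishes at some z > 0, the factor s = z works on all of [0, 1]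
    because F0 (z t) = 0.  Otherwise a bound r < s0 on the upper limit bounds the
    ratio near 0, and rho = r / s0, raised to 1/2 if necessary to be positive. *)
Lemma psi_r_contraction (R : realType) (f : R -> R) (s0 : R) :
  {in `[-1, 1] &, {homo f : x y / x <= y}} -> f 0 = 0 -> 0 < F0 f 1 ->
  0 < s0 < 1 -> (psi_r f s0 < s0%:E)%E ->
  exists s rho tau : R, [/\ 0 < s < 1, 0 < rho < 1, 0 < tau <= 1, 0 < F0 f tau &
    forall t, 0 < t <= tau -> F0 f (s * t) <= rho * (s * F0 f t)].
Proof.
move=> f_nd f00 F01 /andP[s0_gt0 s0_lt1].
rewrite /psi_r; case: asboolP => [[z /andP[z0 z1] Fz] _|noz].
  have z_lt1 : z < 1.
    by rewrite lt_neqAle z1 andbT; apply/eqP => zE; move: F01; rewrite -zE Fz ltxx.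
  exists z, (1 / 2), 1; split => //; [by rewrite z0|lra|by rewrite ltr01 lexx|].
  move=> t /andP[t0 t1].
  have zt0 : 0 < z * t by rewrite mulr_gt0.
  have ztz : z * t <= z by rewrite ler_piMr// ltW.
  have := G0_le f_nd zt0 ztz z1; rewrite /G0 Fz mul0r ler_pdivrMr// mul0r => Fzt.
  apply: (le_trans Fzt); apply: mulr_ge0; first lra.
  by apply: mulr_ge0; [exact: ltW|apply: F0_ge0 => //; lra].
have Fpos t : 0 < t <= 1 -> 0 < F0 f t.
  move=> t1; rewrite lt_neqAle F0_ge0 ?andbT//; last by lra.
  by apply/eqP => Ft; apply: noz; exists t.
rewrite limf_esupE => /ereal_inf_lt[_ [A nA <-]] Alt.
set M := ereal_sup _ in Alt.
have FM t : A t -> ((F0 f (s0 * t) / F0 f t)%:E <= M)%E.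
  by move=> At; apply: ereal_sup_ubound; exists t.
have [r rs0 Mr] : exists2 r : R, r < s0 & (M <= r%:E)%E.
  case: M Alt {FM} => [r| |]//; first by rewrite lte_fin => rs; exists r.
  by move=> _; exists 0 => //; rewrite leNye.
move: nA => /nbhs_ballP[e /= e0 eA].
have tau0 : 0 < Num.min 1 (e / 2) by rewrite lt_min ltr01 divr_gt0.
have tau1 : Num.min 1 (e / 2) <= 1 by rewrite ge_min lexx.
exists s0, (Num.max (r / s0) (1 / 2)), (Num.min 1 (e / 2)); split => //.
- by rewrite s0_gt0.
- apply/andP; split; first by rewrite lt_max; apply/orP; right; lra.
  by rewrite gt_max; apply/andP; split; [rewrite ltr_pdivrMr// mul1r|lra].
- by rewrite tau0.
- by apply: Fpos; rewrite tau0.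
move=> t /andP[t0 tt].
have te : t <= e / 2 by rewrite (le_trans tt)// ge_min lexx orbT.
have At : A t.
  by apply: eA => //; rewrite /ball/= sub0r normrN gtr0_norm//; lra.
have Ft : 0 < F0 f t by apply: Fpos; rewrite t0 (le_trans tt).
have := le_trans (FM t At) Mr; rewrite lee_fin ler_pdivrMr// => /le_trans; apply.
rewrite mulrA ler_pM2r// -ler_pdivrMr//.
by rewrite le_max lexx.
Qed.

(** For S the set of slopes at which [H0] exceeds a level, a tail bound at the
    deterministic slope kappa b covers every random slope in S, while [H0 b] still
    exceeds that level. *)
Lemma almost_least (R : realType) (S : set R) (l kappa : R) :
  S !=set0 -> 0 < l -> lbound S l -> 0 < kappa < 1 ->
  exists2 b, S b & forall a, S a -> kappa * b < a.
Proof.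
move=> S0 l0 Sl /andP[k0 k1].
have hi : has_inf S by split => //; exists l.
have i0 : 0 < inf S by apply: (lt_le_trans l0); exact: lb_le_inf.
have : inf S < inf S / kappa by rewrite ltr_pdivlMr// gtr_pMr.
move=> /(inf_lt S0)[b Sb bk]; exists b => // a Sa.
apply: (@lt_le_trans _ _ (inf S)); first by rewrite mulrC -ltr_pdivlMr.
by apply: ge_inf => //; exists l.
Qed.

(** As g <= 2, C^g is at most 1 + C^2 for every C > 0, so the tail in C^2 is also
    one in C^g, up to the factor [expR c1]. *)
Lemma exp_tails_merge (R : realType) (c1 c2 C g : R) :
  0 < c1 -> 0 < c2 -> 0 < C -> 0 < g <= 2 ->
  9 * expR (- (c1 * C ^+ 2)) + 9 * expR (- (c2 * C `^ g)) <=
  18 * expR c1 * expR (- (Num.min c1 c2 * C `^ g)).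
Proof.
move=> c10 c20 C0 /andP[g0 g2]; set L := Num.min c1 c2.
have Lc1 : L <= c1 by rewrite ge_min lexx.
have Lc2 : L <= c2 by rewrite ge_min lexx orbT.
have Cg0 : 0 <= C `^ g by exact: powR_ge0.
have Cg : C `^ g <= 1 + C ^+ 2.
  have [C1|C1] := leP C 1.
    apply: (@le_trans _ _ 1); last by rewrite lerDl sqr_ge0.
    rewrite (_ : 1 = 1 `^ g); last by rewrite powR1.
    by apply: ge0_ler_powR; rewrite ?nnegrE ?ler01 ?(ltW g0) ?(ltW C0).
  apply: (@le_trans _ _ (C ^+ 2)); last by rewrite lerDr.
  by rewrite -powR_mulrn ?(ltW C0)// ler_powR// ltW.
have E1 : expR (- (c1 * C ^+ 2)) <= expR c1 * expR (- (L * C `^ g)).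
  by rewrite -expRD ler_expR; nra.
have E2 : expR (- (c2 * C `^ g)) <= expR c1 * expR (- (L * C `^ g)).
  by rewrite -expRD ler_expR; nra.
lra.
Qed.

(** Taking m-th roots leaves r^(1/m) in front of a, at most r since r and m are
    at least 1. *)
Lemma powR_inv_le (R : realType) (C K m r a : R) :
  0 < C -> 0 < K -> 1 <= m -> 1 <= r -> 0 < a -> C <= r * (K * a `^ m) ->
  (C / K) `^ m^-1 / r <= a.
Proof.
move=> C0 K0 m1 r1 a0 CK; have m0 : 0 < m by lra.
have r0 : 0 < r by lra.
rewrite ler_pdivrMr//.
have CKm : C / K <= r * a `^ m by rewrite ler_pdivrMr//; lra.
apply: (@le_trans _ _ ((r * a `^ m) `^ m^-1)).
  apply: ge0_ler_powR => //; rewrite ?nnegrE.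
  - by rewrite invr_ge0 ltW.
  - by rewrite divr_ge0// ltW.
  - by rewrite mulr_ge0 ?powR_ge0// ltW.
rewrite powRM ?powR_ge0 ?(ltW r0)// -powRrM divff ?gt_eqF// powRr1 ?(ltW a0)//.
rewrite mulrC ler_pM2l// -[leRHS]powRr1 ?(ltW r0)// ler_powR// invf_le1//.
Qed.

Lemma H0_linear_part (R : realType) (f : R -> R) (ad a : R) :
  0 <= G0inv f ad <= 1 -> 0 <= ad -> ad <= a -> 0 <= H0 f ad a <= a.
Proof.
move=> /andP[t0 t1] ad0 ad_a; rewrite /H0.
have sq1 : Num.sqrt (G0inv f ad) <= 1 by rewrite -sqrtr1 ler_wsqrtr.
have p0 := mulr_ge0 ad0 (sqrtr_ge0 (G0inv f ad)).
have p1 := ler_piMr ad0 sq1.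
case: ifP => [a_ad|_]; last by lra.
have -> : a = ad by lra.
by rewrite p0.
Qed.

(* mu_ext P is the outer probability of P: it equals P on measurable events
   (measurable_mu_extE), and chi is not assumed to be measurable. *)
Theorem theorem1p2 (R : realType) (f0 : R -> R)
    (f0_nd : {in `[-1, 1] &, {homo f0 : x y / x <= y}})
    (f0_L2 : lebesgue_measure.-integrable `[-1, 1]
               (fun x => (f0 x ^+ 2)%:E))
    (f0_cont : {for 0, continuous f0})
    (f0_0 : f0 0 = 0)
    (F0_1 : 0 < F0 f0 1)
    (psi_lt : exists2 s : R, 0 < s < 1 & (psi_r f0 s < s%:E)%E) :
  exists2 astar : R, 0 < astar &
  forall adelta : R, 0 < adelta -> adelta <= F0 f0 1 -> adelta <= astar ->
  forall (chi : R -> R) (K m : R),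
    (forall a, 0 <= a -> 0 <= chi a) ->
    0 < K -> 1 <= m ->
    (forall a, 0 <= a -> a <= adelta -> chi a <= H0 f0 adelta a) ->
    (forall a, adelta < a -> chi a <= K * (H0 f0 adelta a) `^ m) ->
  exists (L1 L2 gamma : R) (n0 : nat),
    [/\ 0 < L1, 0 < L2, 0 < gamma & (0 < n0)%N] /\
    forall n : nat, (n0 <= n)%N -> forall C : R, 0 < C ->
    forall (d : measure_display) (T : measurableType d) (P : probability T R)
      (W : R -> {RV P >-> R}), two_sided_brownian W ->
      (mu_ext P
         [set w | (C <= Num.sqrt n%:R *
                        chi (Num.max 0 (fhat (Yobs f0 n W w) 0)))%R]
       <= (L1 * expR (- (L2 * C `^ gamma)))%:E)%E.
Proof.
have [s [rho [tau [/andP[s0 s1] rho01 /andP[tau0 tau1] Ftau contr]]]] :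
    exists s rho tau : R, [/\ 0 < s < 1, 0 < rho < 1, 0 < tau <= 1, 0 < F0 f0 tau &
      forall t, 0 < t <= tau -> F0 f0 (s * t) <= rho * (s * F0 f0 t)].
  by case: psi_lt => s0 s01 /(psi_r_contraction f0_nd f0_0 F0_1 s01).
have /andP[rho0 rho1] := rho01.
have Gtau : 0 < G0 f0 tau by rewrite divr_gt0.
(* Below half of G0(tau), monotonicity of G0 keeps G0^-1 below tau, where the
   contraction holds. *)
exists (G0 f0 tau / 2); first by rewrite divr_gt0.
move=> ad ad0 adF ad_star chi K m chi0 K0 m1 chi_small chi_large.
pose t_ := G0inv f0.
have t_P b : 0 < b <= ad -> [/\ 0 < t_ b, t_ b <= 1, 0 < s * t_ b <= 1 &
    F0 f0 (s * t_ b) <= rho * b * (s * t_ b)].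
  move=> /andP[b0 b_ad].
  have [/andP[tb0 tb1] Gtb] := G0invP f0_nd f0_0 f0_cont b0 (le_trans b_ad adF).
  have tb_tau : t_ b <= tau.
    rewrite leNgt; apply/negP => /ltW /(G0_le f0_nd tau0) /(_ tb1).
    by rewrite Gtb; lra.
  have Ftb : F0 f0 (t_ b) = b * t_ b.
    by rewrite -{2}Gtb /G0 divfK// gt_eqF.
  split => //; first by rewrite mulr_gt0//= mulr_ile1// ltW.
  have := contr (t_ b); rewrite tb0 tb_tau => /(_ isT).
  by rewrite Ftb => /le_trans; apply; lra.
have [tad0 tad1 stad Fstad] := t_P ad (introT andP (conj ad0 (lexx ad))).
pose kap := (1 - rho) ^+ 2 / 8192.
have kap0 : 0 < kap.
  by rewrite /kap; clear -rho1; apply: divr_gt0; [apply: exprn_gt0; lra|lra].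
pose kappa := (1 + rho) / 2.
have kappa01 : 0 < kappa < 1 by rewrite /kappa; clear -rho0 rho1; apply/andP; split; lra.
have m0 : 0 < m := lt_le_trans ltr01 m1.
pose g := m^-1 * 2.
have g02 : 0 < g <= 2.
  by rewrite mulr_gt0 ?invr_gt0//= ler_piMl// invf_le1.
pose c1 := kap * s; pose c2 := kap * (s * t_ ad) * K^-1 `^ g.
have c10 : 0 < c1 by rewrite mulr_gt0.
have /andP[stad0 _] := stad.
have c20 : 0 < c2.
  by apply: mulr_gt0; [exact: mulr_gt0|rewrite powR_gt0// invr_gt0].
exists (18 * expR c1), (Num.min c1 c2), g, 1%N; split.
  split => //; first by rewrite mulr_gt0 ?ltr0n ?expR_gt0.
    by rewrite lt_min c10.
  by case/andP: g02.
move=> n n0 C C0 d T P W BW.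
set r := Num.sqrt n%:R.
have r1 : 1 <= r by rewrite -sqrtr1 ler_wsqrtr// ler1n.
have r0 : 0 < r := lt_le_trans ltr01 r1.
have rr : r ^+ 2 = n%:R by rewrite sqr_sqrtr.
pose fh w := fhat (Yobs f0 n W w) 0.
pose E1 := [set w | 0 < fh w <= ad /\ C <= r * (fh w * Num.sqrt (t_ (fh w)))].
pose E2 := [set w | ad < fh w /\ C <= r * (K * fh w `^ m)].
apply: (@le_trans _ _ (mu_ext P (E1 `|` E2))).
  apply: le_mu_ext => w /=; rewrite -/(fh w) => Cchi.
  have fh0 : 0 < fh w.
    rewrite ltNge; apply/negP => fh_le0; move: Cchi; rewrite max_l// leNgt.
    (* chi 0 <= H0 0 = 0, so a nonpositive slope gives 0 < C <= 0 *)
    move=> /negP; apply; have := chi_small 0 (lexx _) (ltW ad0).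
    rewrite /H0 (ltW ad0) mul0r => chi00.
    have -> : chi 0 = 0 by apply/eqP; rewrite eq_le chi00 chi0.
    by rewrite mulr0.
  move: Cchi; rewrite max_r ?(ltW fh0)// => Cchi.
  have [fh_ad|ad_fh] := leP (fh w) ad; [left|right]; split => //.
    - by rewrite fh0.
    - apply: (le_trans Cchi); rewrite ler_pM2l//.
      by have := chi_small _ (ltW fh0) fh_ad; rewrite /H0 fh_ad.
  apply: (le_trans Cchi); rewrite ler_pM2l//.
  apply: (le_trans (chi_large _ ad_fh)); rewrite ler_pM2l//.
  have t_ad01 : 0 <= t_ ad <= 1 by rewrite ltW.
  have /andP[H0_0 H0_fh] := H0_linear_part t_ad01 (ltW ad0) (ltW ad_fh).
  by apply: (ge0_ler_powR (ltW m0)); rewrite ?nnegrE// ltW.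
apply: (le_trans (outer_measureU2 (mu_ext P) _ _)).
apply: (@le_trans _ _ ((9 * expR (- (c1 * C ^+ 2)))%:E + (9 * expR (- (c2 * C `^ g)))%:E)%E);
  last by rewrite -EFinD lee_fin exp_tails_merge.
apply: leeD.
  (* Slopes up to ad: the event says that fh w belongs to S. *)
  pose S := [set a : R | 0 < a <= ad /\ C <= r * (a * Num.sqrt (t_ a))].
  have [[a Sa]|S0] := pselect (S !=set0); last first.
    rewrite (_ : E1 = set0).
      by rewrite (outer_measure0 (mu_ext P)) lee_fin mulr_ge0// expR_ge0.
    by apply/seteqP; split => // w Ew; apply: S0; exists (fh w).
  have Slb : lbound S (C / r).
    move=> b [bad Cb]; have [tb0 tb1 _ _] := t_P b bad; case/andP: bad => b0 _.
    rewrite ler_pdivrMr// mulrC (le_trans Cb)// ler_pM2l// ler_piMr ?(ltW b0)//.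
    by rewrite -sqrtr1 ler_wsqrtr.
  have [b [bad Cb] bS] := almost_least (ex_intro _ a Sa) (divr_gt0 C0 r0) Slb kappa01.
  have [tb0 tb1 stb Fstb] := t_P b bad; case/andP: bad => b0 bad.
  apply: (@le_trans _ _ (mu_ext P [set w | kappa * b < fh w])).
    by apply: le_mu_ext => w Ew; exact: bS.
  apply: (le_trans (fhat0_tail f0_nd f0_0 n0 BW b0 rho01 stb Fstb)).
  rewrite lee_fin; apply: ler_wpM2l; first by rewrite ler0n.
  rewrite ler_expR lerN2 -/kap /c1 -mulrA ler_pM2l//.
  rewrite [leRHS](_ : _ = s * (n%:R * b ^+ 2 * t_ b)); last by ring.
  rewrite ler_pM2l//.
  have -> : n%:R * b ^+ 2 * t_ b = (r * (b * Num.sqrt (t_ b))) ^+ 2.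
    by rewrite !exprMn rr sqr_sqrtr ?(ltW tb0)// mulrA.
  by rewrite ler_sqr ?nnegrE// ?(ltW C0)// (le_trans (ltW C0)).
(* Slopes above ad: b is a lower bound of the slopes in the event, and n b^2 is
   at least q^2 = (C / K)^g. *)
pose q := (C / K) `^ m^-1.
have q0 : 0 < q by rewrite powR_gt0// divr_gt0.
pose b := Num.max ad (q / r).
have b0 : 0 < b by rewrite lt_max ad0.
have adb : ad <= b by rewrite le_max lexx.
have qb : q <= r * b by rewrite mulrC -ler_pdivrMr// le_max lexx orbT.
apply: (@le_trans _ _ (mu_ext P [set w | kappa * b < fh w])).
  apply: le_mu_ext => w [ad_fh Cfh] /=.
  have fh0 : 0 < fh w := lt_trans ad0 ad_fh.
  have b_fh : b <= fh w by rewrite ge_max (ltW ad_fh) powR_inv_le.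
  by apply: (lt_le_trans _ b_fh); rewrite gtr_pMl//; case/andP: kappa01.
have Fb : F0 f0 (s * t_ ad) <= rho * b * (s * t_ ad).
  apply: (le_trans Fstad); apply: ler_wpM2r; first by case/andP: stad => /ltW.
  by rewrite ler_pM2l.
apply: (le_trans (fhat0_tail f0_nd f0_0 n0 BW b0 rho01 stad Fb)).
rewrite lee_fin; apply: ler_wpM2l; first by rewrite ler0n.
rewrite ler_expR lerN2 -/kap /c2.
have -> : kap * (s * t_ ad) * K^-1 `^ g * C `^ g = kap * (q ^+ 2 * (s * t_ ad)).
  have -> : q ^+ 2 = K^-1 `^ g * C `^ g.
    rewrite -powRM ?invr_ge0 ?(ltW K0) ?(ltW C0)// mulrC /q /g powRrM.
    by rewrite -powR_mulrn ?powR_ge0.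
  by ring.
rewrite ler_pM2l// ler_wpM2r//; first by case/andP: stad => /ltW.
rewrite -rr -exprMn ler_sqr ?nnegrE ?(ltW q0)//.
by rewrite ltW// mulr_gt0.
Qed.
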